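(* Let $F$ be a field containing a primitive third root of unity $\rho$, let $A$ be a central simple $F$-algebra, and let $B=\{x_1,\dots,x_n\}\subseteq A$ be a coherent $3$-central set with associated directed graph $(B,E_B)$. Then no cycle in $(B,E_B)$ shares a vertex with another (distinct) cycle.
   Context: A finite set $B=\{x_1,\dots,x_n\}$ of invertible elements of $A$ is a $3$-central set if $x_k^3\in F$ for every $k$ and for all $i,j$ there is $c_{i,j}\in\mathbb{Z}/3\mathbb{Z}$ with $x_ix_j=\rho^{c_{i,j}}x_jx_i$. An $F$-subspace $V\subseteq A$ is $3$-central if $v^3\in F$ for every $v\in V$. A $3$-central set is coherent if its elements are linearly independent over $F$ and span a $3$-central space (i.e. it is a basis of a $3$-central space); in such a set no two distinct elements commute. The directed graph $(B,E_B)$ has vertex set $B$ and $(x_i,x_j)\in E_B$ if and only if $x_ix_j=\rho x_jx_i$ (i.e. $c_{i,j}=1$). A cycle is a sequence of vertices $a_1,\dots,a_r$ without repetitions such that $(a_1,a_2),\dots,(a_{r-1},a_r),(a_r,a_1)$ are all edges; cycles differing by a cyclic rotation of the sequence are regarded as the same cycle. *)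

(* Defs.v *)
From mathcomp Require Import all_boot all_order all_algebra all_field.

Set Implicit Arguments.
Unset Strict Implicit.
Unset Printing Implicit Defensive.

Import GRing.Theory.
Local Open Scope ring_scope.

Section ThreeCentral.

Variables (F : fieldType) (A : falgType F).

(* A is unital, so its two-sided ideals (as a ring) are automatically
   F-subspaces; hence quantifying over {vspace A} loses no ideal. *)
Definition two_sided_ideal (I : {vspace A}) : Prop :=
  forall a u : A, u \in I -> (a * u \in I) /\ (u * a \in I).

(* An falgType is finite dimensional and nonzero by definition. *)
Definition central_simple : Prop :=
  'Z({:A})%VS = 1%VS /\
  (forall I : {vspace A}, two_sided_ideal I -> I = 0%VS \/ I = fullv).

(* 1%VS is the line F.1, i.e. the copy of F inside A. *)
Definition three_central_space (V : {vspace A}) : Prop :=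
  forall v : A, v \in V -> v ^+ 3 \in 1%VS.

Variable rho : F.

(* A finite subset of A is given by a list of its elements. *)
Definition three_central_set (B : seq A) : Prop :=
  [/\ uniq B,
      forall x, x \in B -> x \is a GRing.unit,
      forall x, x \in B -> x ^+ 3 \in 1%VS
    & forall x y, x \in B -> y \in B ->
        exists c : 'Z_3, x * y = rho ^+ c *: (y * x)].

Definition coherent (B : seq A) : Prop :=
  [/\ three_central_set B, free B & three_central_space <<B>>%VS].

Definition edge (B : seq A) : rel A :=
  [rel x y | [&& x \in B, y \in B & x * y == rho *: (y * x)]].

(* [ucycle] also accepts the empty list, which shares no vertex with
   anything. *)
Definition digraph_cycle (B c : seq A) : Prop := ucycle (edge B) c.

Definition same_cycle (c d : seq A) : Prop := exists k : nat, d = rot k c.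

End ThreeCentral.

(* Main.v *)
Require Import Defs.
From mathcomp Require Import all_boot all_order all_algebra all_field.
From mathcomp Require Import ring.
Local Open Scope ring_scope.

Set Implicit Arguments.
Unset Strict Implicit.
Unset Printing Implicit Defensive.

Import GRing.Theory.

(** The graph of a coherent 3-central set is a tournament in which every edge
    lies on at most one triangle, and this combinatorial property alone keeps
    distinct cycles apart.

    Adjacency of distinct [x], [y] in [B] amounts to [x * y != y * x].  If they
    commuted, cubing [x + y] and [x + rho y] would give two independent
    combinations of [x^2 y] and [x y^2] that are scalars, so [y^2 x] would be
    a scalar; as [y^3] is one too, [x] and [y] would be proportional
    ([commuting_product_scalar]).

    For a triangle [x -> y -> z -> x], expand the cube of [x + y + z].  Mixed
    terms in two letters cancel because [1 + rho + rho^2 = 0], and the terms in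
    three letters add up to [-3 rho x y z], so [x y z] is a scalar
    ([triangle_product_scalar]).  Hence the edge [x -> y] determines [z] up to
    a scalar, and linear independence of [B] makes [z] unique.

    In such a tournament there is no cycle of length at least 4
    ([no_long_cycle]): the first two chords either give two triangles on a
    common edge or a shorter cycle.  So all cycles are triangles, and two
    distinct triangles through the same vertex would combine into a cycle of
    length 5 ([cycle_tail_uniq]). *)

(** * Tournaments whose edges lie on at most one triangle *)

Section TriangleSparseTournament.

Variables (T : eqType) (e : rel T) (V : {pred T}).
Hypothesis edge_in : forall x y, e x y -> (x \in V) && (y \in V).
Hypothesis edge_asym : forall x y, e x y -> ~~ e y x.
Hypothesis edge_total : forall x y, x \in V -> y \in V -> x != y ->
  e x y || e y x.
Hypothesis triangle_uniq : forall x y z t,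
  e x y -> e y z -> e z x -> e y t -> e t x -> z = t.

Lemma edge_neq x y : e x y -> x != y.
Proof.
by case: eqVneq => // -> yy; have := edge_asym yy; rewrite yy.
Qed.

(** Induction on the length, looking at the chords [a, c] and [b, d].  A chord
    that points forward skips a vertex and leaves a cycle one shorter; when
    both point backward, [a -> b -> c] and [b -> c -> d] close up to triangles
    on the edge [b -> c].  For a 4-cycle the shortened cycle is itself a
    triangle, and each of the four orientations of the chords puts two
    triangles on one edge. *)
Lemma no_long_cycle s a b c d : ~~ ucycleb e [:: a, b, c, d & s].
Proof.
elim: s => [|f s IHs] in a b c d *; apply/negP => /andP[] /=.
  rewrite !inE !negb_or !andbT => /and4P[ab bc cd da].
  move=> /andP[/and3P[nab nac nad] /andP[/andP[nbc nbd] ncd]].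
  have /andP[Va Vb] := edge_in ab; have /andP[Vc Vd] := edge_in cd.
  have /orP[ac|ca] := edge_total Va Vc nac;
    have /orP[bd|db] := edge_total Vb Vd nbd.
  - by rewrite (triangle_uniq da ab bd ac cd) eqxx in nbc.
  - by rewrite (triangle_uniq cd da ac db bc) eqxx in nab.
  - by rewrite (triangle_uniq ab bc ca bd da) eqxx in ncd.
  - by rewrite (triangle_uniq bc cd db ca ab) eqxx in nad.
move=> /and5P[ab bc cd df fs_path] /andP[na /andP[nb /andP[nc uds]]].
move: (na) (nb); rewrite !inE !negb_or => /and5P[_ nac nad _ _] /and4P[_ nbd _ _].
have /andP[Va Vb] := edge_in ab; have /andP[Vc Vd] := edge_in cd.
have /orP[ac|ca] := edge_total Va Vc nac.
  case/negP: (IHs a c d f); rewrite /ucycleb /= ac cd df fs_path nc uds /= andbT.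
  by move: na; rewrite [_ \in b :: _]inE negb_or => /andP[].
have /orP[bd|db] := edge_total Vb Vd nbd.
  case/negP: (IHs a b d f); rewrite /ucycleb /= ab bd df fs_path uds /= andbT.
  move: na nb; rewrite ![_ \in [:: c, d & _]]inE ![_ \in b :: _]inE !inE !negb_or.
  by move=> /and5P[-> _ -> -> ->] /and4P[_ -> -> ->].
by move: nad; rewrite (triangle_uniq bc ca ab cd db) eqxx.
Qed.

Lemma cycle_is_triangle v s :
  ucycle e (v :: s) ->
  exists a b, s = [:: a; b] /\ [&& e v a, e a b & e b v].
Proof.
case: s => [|a [|b [|d s]]]; last by move/(negP (no_long_cycle s v a b d)).
- by rewrite /ucycle /= !andbT => /edge_neq; rewrite eqxx.
- rewrite /ucycle /= andbT => /andP[/andP[va av] _].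
  by move: (edge_asym va); rewrite av.
- by rewrite /ucycle /= andbT => /andP[vab _]; exists a, b.
Qed.

(** Two triangles [v, a, b] and [v, c, d] without a common edge: [a -> d] would
    create a second triangle on [v -> a], so [d -> a], and then
    [v -> c -> d -> a -> b -> v] is a forbidden 5-cycle. *)
Lemma cycle_tail_uniq v s t :
  ucycle e (v :: s) -> ucycle e (v :: t) -> s = t.
Proof.
move=> /cycle_is_triangle[a [b [-> /and3P[va ab bv]]]].
move=> /cycle_is_triangle[c [d [-> /and3P[vc cd dv]]]].
have [eq_ac|nac] := eqVneq a c.
  by rewrite -eq_ac in cd *; rewrite (triangle_uniq va ab bv cd dv).
(* Otherwise [v -> a] and [a -> v], and likewise for [c = b]. *)
have nad : a != d by apply: contraTneq va => ->; apply: edge_asym.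
have ncb : c != b by apply: contraTneq vc => ->; apply: edge_asym.
have /andP[_ Va] := edge_in va; have /andP[Vd _] := edge_in dv.
have /orP[ad|da] := edge_total Va Vd nad.
  have eq_bd := triangle_uniq va ab bv ad dv; rewrite -eq_bd in cd.
  by rewrite (triangle_uniq bv va ab vc cd) eqxx in nac.
have ndb : d != b.
  by apply: contraTneq da => ->; apply: edge_asym.
case/negP: (no_long_cycle [:: b] v c d a).
rewrite /ucycleb /= !inE !negb_or vc cd da ab bv ncb ndb.
rewrite (eq_sym v d) (eq_sym v b).
by rewrite (eq_sym c a) nac !edge_neq.
Qed.

Lemma cycles_meet_rot v c d :
  ucycle e c -> ucycle e d -> v \in c -> v \in d -> exists k, d = rot k c.
Proof.
move=> cyc_c cyc_d /rot_to[i s eq_s] /rot_to[j t eq_t].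
have eq_st: s = t.
  by apply: (@cycle_tail_uniq v); rewrite -?eq_s -?eq_t rot_ucycle.
exists (rot_add c i (size d - j)).
by rewrite -rot_rot_add eq_s eq_st -eq_t -[LHS](rotK j) /rotr size_rot.
Qed.

End TriangleSparseTournament.

(** * Cubes in an algebra over a field with a primitive cube root of unity *)

Section ThreeCentralAlgebra.

Variables (F : fieldType) (A : falgType F) (rho : F).
Hypothesis rho_prim : 3.-primitive_root rho.

Lemma rho_neq1 : rho != 1.
Proof. by rewrite -[rho]expr1 -[1](expr0 rho) (eq_prim_root_expr rho_prim). Qed.

Lemma rho_neq0 : rho != 0.
Proof.
by have := oner_neq0 F; rewrite -(prim_expr_order rho_prim) expf_eq0.
Qed.

Lemma sum_rho_powers : 1 + rho + rho ^+ 2 = 0.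
Proof.
have rho1 : rho - 1 != 0 by rewrite subr_eq0 rho_neq1.
apply: (mulfI rho1); rewrite mulr0 -[RHS](subrr 1) -{3}(prim_expr_order rho_prim).
by ring.
Qed.

(** The part of [(a + b) ^+ 3] of degree 2 in [a] and degree 1 in [b]. *)
Definition cube_cross (a b : A) : A := a * a * b + a * b * a + b * a * a.

Lemma cubeD (a b : A) :
  (a + b) ^+ 3 = a ^+ 3 + cube_cross a b + cube_cross b a + b ^+ 3.
Proof.
rewrite /cube_cross !exprSr expr0 !mul1r !mulrDl !mulrDr !mulrDl !addrA.
by rewrite [LHS](ACl (1*3*2*5*6*7*4*8)).
Qed.

(** Moving [b] to the left turns the three words into [1], [rho] and [rho^2]
    times the same word. *)
Lemma cube_cross_rho (a b : A) :
  a * b = rho *: (b * a) -> cube_cross a b = 0 /\ cube_cross b a = 0.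
Proof.
move=> ab; rewrite /cube_cross.
have aba: a * b * a = rho *: (b * a * a) by rewrite ab -scalerAl.
have bab: b * a * b = rho *: (b * b * a) by rewrite -mulrA ab -scalerAr mulrA.
have aab: a * a * b = rho ^+ 2 *: (b * a * a).
  by rewrite -mulrA ab -scalerAr mulrA aba scalerA.
have abb: a * b * b = rho ^+ 2 *: (b * b * a).
  by rewrite ab -scalerAl bab scalerA.
rewrite aab aba abb bab -{3}[b * a * a]scale1r -{1}[b * b * a]scale1r -!scalerDl.
by rewrite [_ + 1]addrC [_ ^+ 2 + _]addrC addrA sum_rho_powers !scale0r.
Qed.

Lemma cube_crossDl (a b c : A) :
  cube_cross (a + b) c = cube_cross a c + cube_cross b c +
    (a * b * c + b * a * c + a * c * b + b * c * a + c * a * b + c * b * a).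
Proof.
rewrite /cube_cross !mulrDl !mulrDr !mulrDl !addrA.
by rewrite [LHS](ACl (1*5*9*4*8*12*2*3*6*7*11*10)).
Qed.

Lemma cube_crossDr (a b c : A) :
  cube_cross c (a + b) = cube_cross c a + cube_cross c b.
Proof.
rewrite /cube_cross !mulrDl !mulrDr !mulrDl !addrA.
by rewrite [LHS](ACl (1*3*5*2*4*6)).
Qed.

(** Each letter commutes with the product of the other two, so the three cyclic
    rotations of [x * y * z] are equal; each of the three odd words is [rho^2] times that product.  The
    total coefficient is [3 + 3 rho^2 = - 3 rho]. *)
Lemma triangle_symmetrized (x y z : A) :
  x * y = rho *: (y * x) -> y * z = rho *: (z * y) -> z * x = rho *: (x * z) ->
  x * y * z + y * x * z + x * z * y + y * z * x + z * x * y + z * y * x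
    = (- 3 * rho) *: (x * y * z).
Proof.
have inv (a b : A) : a * b = rho *: (b * a) -> b * a = rho ^+ 2 *: (a * b).
  by move=> ->; rewrite scalerA -exprSr (prim_expr_order rho_prim) scale1r.
move=> xy yz zx; have [[yx zy] xz] := (inv _ _ xy, inv _ _ yz, inv _ _ zx).
have eq_yxz: y * x * z = rho ^+ 2 *: (x * y * z) by rewrite yx -scalerAl.
have eq_xzy: x * z * y = rho ^+ 2 *: (x * y * z).
  by rewrite -mulrA zy -scalerAr mulrA.
have eq_yzx: y * z * x = x * y * z.
  rewrite -mulrA zx -scalerAr mulrA eq_yxz scalerA -exprS.
  by rewrite (prim_expr_order rho_prim) scale1r.
have eq_zxy: z * x * y = x * y * z.
  rewrite zx -scalerAl eq_xzy scalerA -exprS.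
  by rewrite (prim_expr_order rho_prim) scale1r.
have eq_zyx: z * y * x = rho ^+ 2 *: (x * y * z) by rewrite zy -scalerAl eq_yzx.
rewrite eq_yxz eq_xzy eq_yzx eq_zxy eq_zyx; set u := x * y * z.
rewrite -{1 4 5}[u]scale1r -!scalerDl; congr (_ *: _).
apply/eqP; rewrite -subr_eq0 -[X in _ == X](mulr0 3) -sum_rho_powers.
by apply/eqP; ring.
Qed.

Lemma triangle_product_scalar (x y z : A) :
    x * y = rho *: (y * x) -> y * z = rho *: (z * y) ->
    z * x = rho *: (x * z) ->
    x ^+ 3 \in 1%VS -> y ^+ 3 \in 1%VS -> z ^+ 3 \in 1%VS ->
    (x + y + z) ^+ 3 \in 1%VS ->
  x * y * z \in 1%VS.
Proof.
move=> xy yz zx x3 y3 z3; rewrite cubeD cubeD cube_crossDl cube_crossDr.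
rewrite (triangle_symmetrized xy yz zx).
have [-> ->] := cube_cross_rho xy; have [-> ->] := cube_cross_rho yz.
have [-> ->] := cube_cross_rho zx; rewrite !addr0 add0r.
rewrite (rpredDr _ z3) (rpredDl _ (rpredD x3 y3)) rpredZeq.
have rho3 : - 3 * rho != 0 :> F.
  by rewrite mulf_neq0 ?rho_neq0 // oppr_eq0 (prim_root_natf_neq0 rho_prim).
by rewrite (negPf rho3).
Qed.

(** The cube of [x + k y] shows that [k x^2 y + k^2 y^2 x] is a scalar; the
    values [k = 1] and [k = rho] suffice to separate the two terms.  Using
    [rho] rather than [-1] keeps the argument valid in characteristic 2. *)
Lemma commuting_product_scalar (x y : A) :
    x * y = y * x -> x ^+ 3 \in 1%VS -> y ^+ 3 \in 1%VS ->
    (forall k : F, (x + k *: y) ^+ 3 \in 1%VS) ->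
  y ^+ 2 * x \in 1%VS.
Proof.
move=> xy x3 y3 cubeV.
have cross k : k *: (x * x * y) + k ^+ 2 *: (y ^+ 2 * x) \in 1%VS.
  have := cubeV k; rewrite cubeD exprZn.
  rewrite (rpredDr _ (rpredZ _ y3)) -addrA (rpredDl _ x3).
  have -> : cube_cross x (k *: y) = 3 *: (k *: (x * x * y)).
    rewrite /cube_cross -!scalerAr -!scalerAl -xy -![x * y * x]mulrA -xy mulrA.
    by rewrite scaler_nat mulrSr mulr2n.
  have -> : cube_cross (k *: y) x = 3 *: (k ^+ 2 *: (y ^+ 2 * x)).
    rewrite /cube_cross !(=^~ scalerAr, =^~ scalerAl).
    rewrite xy -![y * x * y]mulrA xy mulrA -expr2 !scalerA -expr2.
    by rewrite -scalerA scaler_nat mulrSr mulr2n.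
  by rewrite -scalerDr rpredZeq (negPf (prim_root_natf_neq0 rho_prim)).
have := rpredB (rpredZ rho (cross 1)) (cross rho).
rewrite scale1r expr1n scale1r scalerDr opprD addrACA subrr add0r -scalerBl.
rewrite -{1}[rho]mulr1 expr2 -mulrBr rpredZeq mulf_eq0 (negPf rho_neq0) /=.
by rewrite subr_eq0 eq_sym (negPf rho_neq1).
Qed.

(** Both [x] and [y] lie on the line spanned by the inverse of [a]. *)
Lemma collinear_of_scalar_mul (a x y : A) :
    a \is a GRing.unit -> y != 0 -> a * x \in 1%VS -> a * y \in 1%VS ->
  x \in <[y]>%VS.
Proof.
move=> aU y0 /vlineP[k ax] /vlineP[l ay].
have l0 : l != 0.
  apply: contraNneq y0 => l0; apply/eqP/(mulrI aU).
  by rewrite ay l0 scale0r mulr0.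
apply/vlineP; exists (k / l); apply: (mulrI aU).
by rewrite -scalerAr ax ay scalerA divfK.
Qed.

Lemma free_collinear_eq (B : seq A) (x y : A) :
  free B -> x \in B -> y \in B -> x \in <[y]>%VS -> x = y.
Proof.
move=> freeB Bx By xy; apply/eqP; apply: contraTT freeB => nxy.
rewrite (perm_free (perm_to_rem Bx)) free_cons negb_and negbK.
apply/orP; left; apply: subvP xy.
rewrite -memvE memv_span //; have := By.
by rewrite (perm_mem (perm_to_rem Bx)) inE eq_sym (negPf nxy).
Qed.

End ThreeCentralAlgebra.

(** * The graph of a coherent 3-central set *)

Theorem proposition3p3 (F : fieldType) (rho : F)
    (rho_prim : 3.-primitive_root rho)
    (A : falgType F) (csA : central_simple A)
    (B : seq A) (cohB : coherent rho B)
    (c d : seq A) (cycle_c : digraph_cycle rho B c)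
    (cycle_d : digraph_cycle rho B d) (neq_cd : ~ same_cycle c d) :
  ~ (exists v : A, v \in c /\ v \in d).
Proof.
case: cohB => -[_ unitB cubeB rhoB] freeB cubeV [v [v_c v_d]].
have spanB x : x \in B -> x \in <<B>>%VS by move=> ?; apply: memv_span.
have B0 x : x \in B -> x != 0.
  by move=> /unitB; apply: contraTneq => ->; rewrite unitr0.
apply: neq_cd.
apply: (@cycles_meet_rot _ (edge rho B) (mem B) _ _ _ _ v) => //=.
- by move=> x y /and3P[-> ->].
- move=> x y /and3P[Bx By /eqP xy]; apply/negP=> /and3P[_ _ /eqP yx].
  (* Substituting one relation into the other yields [x y = rho^2 x y]. *)
  have := xy; rewrite yx scalerA -expr2 -{1}[x * y]scale1r => /eqP.
  rewrite -subr_eq0 -scalerBl scaler_eq0 subr_eq0 eq_sym -(expr0 rho).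
  rewrite (eq_prim_root_expr rho_prim) /= => /eqP xy0.
  by case/eqP: (B0 _ By); apply: (mulrI (unitB _ Bx)); rewrite xy0 mulr0.
- move=> x y Bx By nxy; rewrite /edge /= Bx By /=.
  have [[[|[|[|//]]] /= ltc] xy] := rhoB x y Bx By.
  + case/eqP: nxy; apply: (free_collinear_eq freeB) => //.
    rewrite expr0 scale1r in xy.
    apply: (@collinear_of_scalar_mul _ _ (y ^+ 2));
      rewrite ?unitrX ?unitB ?B0 //.
      apply: (commuting_product_scalar rho_prim xy); rewrite ?cubeB // => k.
      by rewrite cubeV ?rpredD ?rpredZ ?spanB.
    by rewrite -exprSr cubeB.
  + by rewrite xy eqxx.
  + by rewrite xy scalerA -exprS (prim_expr_order rho_prim) scale1r eqxx orbT.
- move=> x y z t /and3P[Bx By /eqP xy] /and3P[_ Bz /eqP yz] /and3P[_ _ /eqP zx].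
  move=> /and3P[_ Bt /eqP yt] /and3P[_ _ /eqP tx].
  have product_scalar w : w \in B -> y * w = rho *: (w * y) ->
      w * x = rho *: (x * w) -> x * y * w \in 1%VS.
    move=> Bw yw wx; apply: (triangle_product_scalar rho_prim xy yw wx);
      [exact: cubeB | exact: cubeB | exact: cubeB | by rewrite cubeV ?rpredD ?spanB].
  apply: (free_collinear_eq freeB) => //.
  apply: (@collinear_of_scalar_mul _ _ (x * y)); rewrite ?unitrMl ?unitB ?B0 //.
    exact: product_scalar.
  exact: product_scalar.
Qed.
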